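(* For every real $\alpha > 1$, the series $\sum_{n=1}^\infty \frac{1}{Z(n)^\alpha}$ is convergent.
   Context: For a positive integer $m$ let $T(m) = m(m+1)/2$. The pseudo-Smarandache function is defined for positive integers $n$ by $Z(n) = \min\{ m \ge 1 : n \mid T(m) \}$. *)

(* Defs.v *)
From mathcomp Require Import all_boot.

Set Implicit Arguments.
Unset Strict Implicit.
Unset Printing Implicit Defensive.

Definition triangular (m : nat) : nat := (m * (m + 1)) %/ 2.

Lemma triangular_dvd_ex (n : nat) :
  exists m, (1 <= m) && (n.+1 %| triangular m).
Proof.
exists (2 * n).+1; rewrite /triangular /=.
have -> : (2 * n).+1 + 1 = n.+1 * 2 by rewrite [RHS]mulnC mulnS addn1.
by rewrite mulnA mulnK // dvdn_mull.
Qed.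

(* The value at 0 is a convention: 0 divides no triangular m with 1 <= m. *)
Definition pseudo_smarandache (n : nat) : nat :=
  if n is n'.+1 then ex_minn (triangular_dvd_ex n') else 0.

Lemma pseudo_smarandacheP (n : nat) : 0 < n ->
  [/\ 1 <= pseudo_smarandache n,
      n %| triangular (pseudo_smarandache n) &
      forall m, 1 <= m -> n %| triangular m -> pseudo_smarandache n <= m].
Proof.
case: n => // n _ /=; case: ex_minnP => m /andP[m_gt0 dvd_m] min_m.
by split=> // k k_gt0 dvd_k; apply: min_m; rewrite k_gt0.
Qed.

(* Main.v *)
(* Every n with Z(n) = m divides T(m), so the partial sums are bounded by
   those of the sum over m of d(T(m)) m^-alpha, where d counts divisors.
   Submultiplicativity of d gives d(T(m)) <= d(m)d(m+1) <= d(m)^2 + d(m+1)^2.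
   For submultiplicative f >= 0, the sum of d(m) f(m) over m <= M is at most the
   square of the sum of f; applying this to f(m) = d(m) m^-alpha and then to
   m^-alpha bounds the sum of d(m)^2 m^-alpha by zeta(alpha)^4. *)

Require Import Defs.
From mathcomp Require Import all_boot all_order all_algebra.
From mathcomp Require Import all_classical all_reals all_analysis.
From mathcomp Require Import zify lra.
Set Implicit Arguments.
Unset Strict Implicit.
Unset Printing Implicit Defensive.

Import Order.TTheory GRing.Theory Num.Theory.
Import numFieldNormedType.Exports.
Local Open Scope classical_set_scope.
Local Open Scope ring_scope.

(** The map [c |-> (gcdn c a, c %/ gcdn c a)] sends divisors of [a * b] to pairs of a divisor of [a]
    and a divisor of [b]. It is injective because the product of the pair is [c]. *)
Lemma count_divisors_mul (a b : nat) : (0 < a)%N -> (0 < b)%N ->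
  (size (divisors (a * b)) <= size (divisors a) * size (divisors b))%N.
Proof.
move=> a_gt0 b_gt0.
rewrite -(size_allpairs (fun x y : nat => (x, y))).
pose split_divisor c := (gcdn c a, c %/ gcdn c a)%N.
rewrite -(size_map split_divisor).
apply: uniq_leq_size.
  rewrite map_inj_in_uniq ?divisors_uniq// => c c' _ _ [gE qE].
  by rewrite -(divnK (dvdn_gcdl c a)) qE gE divnK ?dvdn_gcdl.
move=> _ /mapP[c + ->]; rewrite -dvdn_divisors ?muln_gt0 ?a_gt0// => c_dvd.
apply/allpairsP; exists (split_divisor c) => /=; split=> //.
  by rewrite -dvdn_divisors ?dvdn_gcdr.
have g_gt0 : (0 < gcdn c a)%N by rewrite gcdn_gt0 a_gt0 orbT.
rewrite -dvdn_divisors//.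
(* Dividing [c %| a * b] by the gcd gives [c %/ g %| (a %/ g) * b]; by coprimality, Gauss's lemma
   removes the factor [a %/ g]. *)
have cop : coprime (c %/ gcdn c a) (a %/ gcdn c a).
  rewrite /coprime -(eqn_pmul2r g_gt0) muln_gcdl !divnK ?dvdn_gcdl ?dvdn_gcdr//.
  by rewrite mul1n.
rewrite -(Gauss_dvdr _ cop) -(dvdn_pmul2r g_gt0) divnK ?dvdn_gcdl//.
by rewrite mulnAC divnK ?dvdn_gcdr.
Qed.

Lemma count_divisors_dvd (a b : nat) : (0 < b)%N -> (a %| b)%N ->
  (size (divisors a) <= size (divisors b))%N.
Proof.
move=> b_gt0 ab; apply: uniq_leq_size (divisors_uniq a) _ => d.
rewrite -!dvdn_divisors ?(dvdn_gt0 b_gt0 ab)// => da.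
exact: dvdn_trans da ab.
Qed.

Lemma triangular_gt0 (m : nat) : (0 < m)%N -> (0 < triangular m)%N.
Proof. by rewrite /triangular => m_gt0; rewrite divn_gt0//; nia. Qed.

Lemma count_divisors_triangular (m : nat) : (0 < m)%N ->
  (size (divisors (triangular m))
    <= size (divisors m) ^ 2 + size (divisors m.+1) ^ 2)%N.
Proof.
move=> m_gt0; have m1_gt0 : (0 < m * m.+1)%N by rewrite muln_gt0 m_gt0.
have dvd : (triangular m %| m * m.+1)%N.
  rewrite /triangular addn1; apply/dvdnP; exists 2.
  by rewrite [RHS]mulnC divnK// dvdn2 oddM /= andbN.
apply: leq_trans (count_divisors_dvd m1_gt0 dvd) _.
apply: leq_trans (count_divisors_mul m_gt0 (ltn0Sn m)) _.
exact: leq_trans (leq_pmull _ (ltn0Sn 1)) (nat_Cauchy _ _).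
Qed.

Lemma sum_indicator (T : Type) (s : seq T) (P : pred T) :
  (\sum_(i <- s) (P i : nat) = count P s)%N.
Proof.
rewrite -sum1_count [RHS]big_mkcond /=.
by apply: eq_bigr => i _; case: (P i).
Qed.

Section NumericSums.
Variable R : realFieldType.
Implicit Types f : nat -> R.

(* Writing [m = a * k] for every divisor [a] of [m], the left-hand side becomes
   a sum over pairs [(a, k)]. *)
Lemma sum_count_divisors_le f (M : nat) :
  (forall m, 0 <= f m) ->
  (forall a b, (0 < a)%N -> (0 < b)%N -> f (a * b)%N <= f a * f b) ->
  \sum_(1 <= m < M.+1) (size (divisors m))%:R * f m
    <= (\sum_(1 <= m < M.+1) f m) ^+ 2.
Proof.
move=> f_ge0 f_mul.
have dvd_le m : (1 <= m < M.+1)%N -> (size (divisors m))%:R * f m <=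
    \sum_(1 <= a < M.+1) \sum_(1 <= k < M.+1) (a * k == m)%N%:R * (f a * f k).
  move=> /andP[m_gt0 m_le].
  apply: (@le_trans _ _ (\sum_(1 <= a < M.+1) (a %| m)%N%:R * f m)).
    rewrite -mulr_suml ler_wpM2r// -natr_sum ler_nat sum_indicator -size_filter.
    apply: uniq_leq_size (divisors_uniq m) _ => a.
    rewrite -dvdn_divisors// mem_filter mem_index_iota => am.
    by rewrite am (dvdn_gt0 m_gt0 am) (leq_ltn_trans (dvdn_leq m_gt0 am)).
  apply: ler_sum_nat => a /andP[a_gt0 _].
  have [/dvdnP[k mE]|_] := boolP (a %| m)%N; last first.
    by rewrite mul0r sumr_ge0// => k _; rewrite !mulr_ge0.
  have k_gt0 : (0 < k)%N by lia.
  (* The single term of the cofactor [k = m / a] already suffices, by submultiplicativity. *)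
  rewrite (bigD1_seq k) ?iota_uniq//= ?mem_index_iota ?k_gt0; last by nia.
  rewrite mE mulnC eqxx !mul1r ler_wpDr ?f_mul//.
  by rewrite sumr_ge0// => j _; rewrite !mulr_ge0.
apply: le_trans (ler_sum_nat dvd_le) _.
rewrite exchange_big_nat /= expr2 mulr_suml ler_sum_nat// => a _.
rewrite exchange_big_nat /= mulr_sumr ler_sum_nat// => k _.
(* A fixed pair [(a, k)] is hit by at most one [m], so its indicators sum to at most 1. *)
rewrite -mulr_suml ler_piMl ?mulr_ge0// -natr_sum sum_indicator.
rewrite (eq_count (a2 := pred1 (a * k)%N)) => [|m]; last by rewrite eq_sym.
by rewrite count_uniq_mem ?iota_uniq// lern1 leq_b1.
Qed.

(** Cauchy condensation in closed form. Writing S(M) for the sum, pairing the terms at 2m and 2m+1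
    gives S(M) <= S(2M+1) <= f(1) + 2 f(2) S(M), which is solved for S(M) since 2 f(2) < 1. *)
Lemma dyadic_sum_le f (M : nat) :
  (forall m, 0 <= f m) ->
  (forall m, (0 < m)%N -> f m.+1 <= f m) ->
  (forall m, f (2 * m)%N = f 2%N * f m) -> f 2%N < 2^-1 ->
  \sum_(1 <= m < M.+1) f m <= f 1%N / (1 - 2 * f 2%N).
Proof.
move=> f_ge0 f_dec f_dbl f2_lt.
have step : \sum_(1 <= m < (2 * M).+2) f m <=
    f 1%N + 2 * f 2%N * \sum_(1 <= m < M.+1) f m.
  elim: M => [|M IH].
    by rewrite muln0 big_nat1 [X in _ * X]big_geq// mulr0 addr0.
  have -> : ((2 * M.+1).+2 = (2 * M).+4)%N by lia.
  rewrite [X in X <= _]big_nat_recr//= [X in X + _ <= _]big_nat_recr//=.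
  rewrite [X in _ * X]big_nat_recr//=.
  (* Both new terms, at 2M+2 and 2M+3, are at most f(2) f(M+1). *)
  have := f_dec (2 * M).+2 isT; have := f_dbl M.+1.
  have -> : (2 * M.+1 = (2 * M).+2)%N by lia.
  by move=> -> ?; lra.
have mono : \sum_(1 <= m < M.+1) f m <= \sum_(1 <= m < (2 * M).+2) f m.
  rewrite [leRHS](@big_cat_nat _ _ _ M.+1)//=; last by lia.
  by rewrite lerDl sumr_ge0.
by rewrite ler_pdivlMr; lra.
Qed.

(** The [n] are grouped by their value [m] of [pseudo_smarandache]; the bound [M] ensures that no
    group is missed. *)
Lemma sum_pseudo_smarandache_le f (M N : nat) :
  (forall m, 0 <= f m) ->
  (forall n, (0 < n <= N)%N -> (pseudo_smarandache n <= M)%N) ->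
  \sum_(1 <= n < N.+1) f (pseudo_smarandache n)
    <= \sum_(1 <= m < M.+1) (size (divisors (triangular m)))%:R * f m.
Proof.
move=> f_ge0 Z_le.
apply: (@le_trans _ _ (\sum_(1 <= n < N.+1) \sum_(1 <= m < M.+1)
    (pseudo_smarandache n == m)%:R * f m)).
  apply: ler_sum_nat => n n_range; have n_gt0 : (0 < n)%N by lia.
  have [Z_gt0 _ _] := pseudo_smarandacheP n_gt0.
  rewrite (bigD1_seq (pseudo_smarandache n)) ?iota_uniq//=; last first.
    by rewrite mem_index_iota Z_gt0 ltnS Z_le.
  by rewrite eqxx mul1r lerDl sumr_ge0// => m _; rewrite mulr_ge0.
rewrite exchange_big_nat /=; apply: ler_sum_nat => m /andP[m_gt0 _].
rewrite -mulr_suml ler_wpM2r// -natr_sum ler_nat.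
rewrite (sum_indicator _ (fun n => pseudo_smarandache n == m)) -size_filter.
apply: uniq_leq_size => [|n]; first by rewrite filter_uniq ?iota_uniq.
rewrite mem_filter mem_index_iota => /andP[/eqP Zn /andP[n_gt0 _]].
have [_ + _] := pseudo_smarandacheP n_gt0.
by rewrite Zn -dvdn_divisors ?triangular_gt0.
Qed.

Lemma sum_sqr_count_divisors_le f (M : nat) :
  (forall m, 0 <= f m) ->
  (forall a b, (0 < a)%N -> (0 < b)%N -> f (a * b)%N <= f a * f b) ->
  \sum_(1 <= m < M.+1) (size (divisors m))%:R ^+ 2 * f m
    <= (\sum_(1 <= m < M.+1) f m) ^+ 4.
Proof.
move=> f_ge0 f_mul; pose g m : R := (size (divisors m))%:R * f m.
have g_ge0 m : 0 <= g m by rewrite mulr_ge0.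
have g_mul a b : (0 < a)%N -> (0 < b)%N -> g (a * b)%N <= g a * g b.
  move=> a_gt0 b_gt0; rewrite /g mulrACA ler_pM ?f_mul//.
  by rewrite -natrM ler_nat count_divisors_mul.
under eq_bigr do rewrite expr2 -mulrA.
apply: le_trans (@sum_count_divisors_le g M g_ge0 g_mul) _.
rewrite (exprM _ 2 2) lerXn2r ?nnegrE ?exprn_ge0 ?sumr_ge0//.
exact: sum_count_divisors_le.
Qed.

(** The constant [K] turns the mixed term d(m+1)^2 f(m) into d(m+1)^2 f(m+1), so both halves are
    sums of d^2 f, one of them shifted; hence the range up to M+1 on the right. *)
Lemma sum_count_divisors_triangular_le f (K : R) (M : nat) :
  (forall m, 0 <= f m) ->
  (forall a b, (0 < a)%N -> (0 < b)%N -> f (a * b)%N <= f a * f b) ->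
  0 <= K -> (forall m, (0 < m)%N -> f m <= K * f m.+1) ->
  \sum_(1 <= m < M.+1) (size (divisors (triangular m)))%:R * f m
    <= (1 + K) * (\sum_(1 <= m < M.+2) f m) ^+ 4.
Proof.
move=> f_ge0 f_mul K_ge0 f_shift.
pose g m : R := (size (divisors m))%:R ^+ 2 * f m.
have g_ge0 m : 0 <= g m by rewrite mulr_ge0 ?exprn_ge0.
have g_le := sum_sqr_count_divisors_le M.+1 f_ge0 f_mul.
apply: le_trans (ler_wpM2l _ g_le); last by rewrite addr_ge0.
rewrite mulrDl mul1r.
apply: (@le_trans _ _ (\sum_(1 <= m < M.+1) (g m + K * g m.+1))).
  apply: ler_sum_nat => m /andP[m_gt0 _].
  have : (size (divisors (triangular m)))%:R <=
      (size (divisors m))%:R ^+ 2 + (size (divisors m.+1))%:R ^+ 2 :> R.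
    by rewrite -!natrX -natrD ler_nat count_divisors_triangular.
  move=> /(ler_wpM2r (f_ge0 m)) /le_trans; apply.
  rewrite mulrDl lerD2l /g mulrCA ler_wpM2l ?exprn_ge0//.
  exact: f_shift.
rewrite big_split /= -mulr_sumr lerD//.
  by rewrite [leRHS]big_nat_recr//= lerDl g_ge0.
by rewrite ler_wpM2l// -/g [leRHS]big_nat_recl//= lerDr mulr_ge0 ?exprn_ge0.
Qed.

End NumericSums.

Theorem theorem6 (R : realType) (alpha : R) (halpha : 1 < alpha) :
  cvgn (fun N : nat =>
    \sum_(1 <= n < N.+1) 1 / ((pseudo_smarandache n)%:R `^ alpha) : R).
Proof.
pose f (m : nat) : R := 1 / (m%:R `^ alpha).
have f_ge0 m : 0 <= f m by rewrite divr_ge0 ?powR_ge0.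
have f_mul a b : f (a * b)%N = f a * f b.
  by rewrite /f natrM powRM// !div1r invfM.
have f_le m n : (0 < m <= n)%N -> f n <= f m.
  move=> /andP[m_gt0 mn]; rewrite /f !div1r lef_pV2 ?posrE ?powR_gt0 ?ltr0n//.
    by rewrite ge0_ler_powR ?nnegrE ?ler_nat//; lra.
  exact: leq_trans mn.
have f2_gt0 : 0 < f 2%N by rewrite divr_gt0 ?powR_gt0 ?ltr0n.
(* This is where [1 < alpha] is decisive: 2 < 2^alpha. *)
have f2_lt : f 2%N < 2^-1.
  rewrite /f div1r ltf_pV2 ?posrE ?powR_gt0 ?ltr0n//.
  rewrite -[ltLHS]powRr1// /powR pnatr_eq0 /= ltr_expR.
  by rewrite ltr_pM2r ?ln_gt0 ?ltr1n.
(* Since m+1 <= 2m, f(2) f(m) = f(2m) <= f(m+1). *)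
have f_shift m : (0 < m)%N -> f m <= (f 2%N)^-1 * f m.+1.
  by move=> m_gt0; rewrite ler_pdivlMl// -f_mul f_le//; lia.
have f_dec m : (0 < m)%N -> f m.+1 <= f m.
  by move=> m_gt0; rewrite f_le// m_gt0/=.
apply: nondecreasing_is_cvgn.
  by apply/nondecreasing_seqP => n; rewrite [leRHS]big_nat_recr//= lerDl f_ge0.
exists ((1 + (f 2%N)^-1) * (f 1%N / (1 - 2 * f 2%N)) ^+ 4).
move=> _ [N _ <-].
(* [M] depends on [N], but the bound from [dyadic_sum_le] is uniform in [M]. *)
pose M := (\max_(1 <= n < N.+1) pseudo_smarandache n)%N.
apply: le_trans (@sum_pseudo_smarandache_le _ f M N f_ge0 _) _.
  by move=> n n_range; apply: leq_bigmax_seq; rewrite ?mem_index_iota.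
apply: le_trans (@sum_count_divisors_triangular_le _ f (f 2%N)^-1 M f_ge0 _ _ _) _ => //.
- by move=> a b _ _; rewrite f_mul.
- by rewrite invr_ge0 ltW.
rewrite ler_wpM2l ?addr_ge0 ?invr_ge0 ?(ltW f2_gt0)//.
have sum_le := @dyadic_sum_le _ f M.+1 f_ge0 f_dec (f_mul 2%N) f2_lt.
by rewrite lerXn2r ?nnegrE ?(le_trans _ sum_le) ?sumr_ge0.
Qed.
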